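(* Let $X$ be a well-ordered set and let $\geq_{\rm IM}$ be an invariant monomial order on $\mathfrak{S}(X)$. Then the operated Lie algebra $\mathrm{OLie}(X)$ (with operator $w\mapsto\lfloor w\rfloor$), together with the natural embedding $X\to \mathrm{OLie}(X)$, is a free operated Lie algebra on $X$, and the set $\mathrm{NLSBW}(X)$ of non-associative Lyndon-Shirshov bracketed words with respect to $\geq_{\rm IM}$ is a linear basis of $\mathrm{OLie}(X)$.
   Context: Let $\mathbf{k}$ be a field. An operated Lie algebra is a Lie algebra $L$ over $\mathbf k$ with a linear map $P_L:L\to L$; morphisms are Lie algebra homomorphisms commuting with the operators. ''Free on $X$'' means the usual universal property: every map from $X$ to an operated Lie algebra extends uniquely to a morphism of operated Lie algebras. Bracketed words. For a set $Y$, $S(Y)$ is the free semigroup on $Y$ (nonempty words) and $\lfloor Y\rfloor=\{\lfloor y\rfloor : y\in Y\}$ is a disjoint copy of $Y$. Put $\mathfrak{S}(X)_0=S(X)$, $\mathfrak{S}(X)_{n+1}=S(X\sqcup\lfloor\mathfrak{S}(X)_n\rfloor)$ (with the natural inclusions) and $\mathfrak{S}(X)=\bigcup_n\mathfrak{S}(X)_n$. Elements of $X\sqcup\lfloor\mathfrak{S}(X)\rfloor$ are called prime; every $w\in\mathfrak{S}(X)$ is uniquely a product $w_1\cdots w_k$ of primes. $\mathbf{k}\mathfrak{S}(X)$ is the semigroup algebra, with linear operator $\lfloor\ \rfloor$. $\mathfrak{S}^\star(X)$ is the set of words in $\mathfrak{S}(X\sqcup\{\star\})$ in which $\star$ occurs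 exactly once; $q|_u$ is obtained from $q\in\mathfrak{S}^\star(X)$ by replacing $\star$ by $u$. Orders. A monomial order on $\mathfrak{S}(X)$ is a well order $\geq$ with $u>v\Rightarrow q|_u>q|_v$ for all $u,v\in\mathfrak{S}(X)$, $q\in\mathfrak{S}^\star(X)$. It is invariant if for all primes $u_1,\dots,u_n$ and every permutation $\sigma$: $u_1\cdots u_n\geq u_{\sigma(1)}\cdots u_{\sigma(n)}\iff u_1\cdots u_n\succeq_{\rm lex}u_{\sigma(1)}\cdots u_{\sigma(n)}$, where $\succeq$ is the restriction of $\geq$ to primes. Here, for a well-ordered alphabet $A$, the lex-order on words is defined by: the empty word is larger than every nonempty word, and $xu'>_{\rm lex}yv'$ ($x,y\in A$) if $x>y$, or $x=y$ and $u'>_{\rm lex}v'$. Lyndon-Shirshov words. For a well-ordered alphabet $A$, $w\in S(A)$ is an associative Lyndon-Shirshov word, $w\in\mathrm{ALSW}(A)$, if $uv>_{\rm lex}vu$ for every decomposition $w=uv$ with $u,v\in S(A)$. A non-associative binary word $(w)$ on $A$ is a non-associative Lyndon-Shirshov word if its underlying associative word $w$ is in $\mathrm{ALSW}(A)$; whenever $(w)=((u)(v))$, both $(u),(v)$ are non-associative Lyndon-Shirshov words; and whenever $(w)=((u)(v))$ with $(u)=((u_1)(u_2))$, one has $v\geq_{\rm lex}u_2$. Each $w\in\mathrm{ALSW}(A)$ has a unique bracketing $[w]$ that is a non-associative Lyndon-Shirshov word. Bracketed version. With respect to a fixed invariant monomial order $\geq_{\rm IM}$ (primes ordered by its restriction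 $\succeq$): $\mathrm{ALSBW}(X)_0=\mathrm{ALSW}(X)$, $\mathrm{ALSBW}(X)_{n+1}=\mathrm{ALSW}(X\sqcup\lfloor\mathrm{ALSBW}(X)_n\rfloor)$, $\mathrm{ALSBW}(X)=\bigcup_n\mathrm{ALSBW}(X)_n$. For $w\in\mathrm{ALSBW}(X)$ define $[w]$ recursively: $[x]=x$ for $x\in X$; $[\lfloor w'\rfloor]=\lfloor[w']\rfloor$; and for $w=w_1\cdots w_k$ with $w_i$ prime, $k>1$, $[w]$ is the non-associative Lyndon-Shirshov bracketing of the word $[w_1]\cdots[w_k]$ on the letters $[w_i]$, ordered as the $w_i$. $\mathrm{NLSBW}(X)=\{[w]: w\in\mathrm{ALSBW}(X)\}$. Non-associative bracketed words are regarded as elements of $\mathbf{k}\mathfrak{S}(X)$ by reading each binary product $(a\,b)$ as the commutator $ab-ba$. $\mathrm{OLie}(X)$ is the operated Lie subalgebra of $\mathbf{k}\mathfrak{S}(X)$ generated by $X$: the smallest subspace containing $X$ and closed under the commutator and under $\lfloor\ \rfloor$. *)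

(* Defs.v *)
From HB Require Import structures.
From mathcomp Require Import all_boot all_algebra finmap monalg.
From mathcomp Require Import boolp wochoice.

Set Implicit Arguments.
Unset Strict Implicit.
Unset Printing Implicit Defensive.

Import GRing.Theory.
Local Open Scope ring_scope.

HB.mixin Record isLieAlgebra (k : fieldType) L of GRing.Lmodule k L := {
  lie : L -> L -> L;
  lie_linearl : forall y, linear (lie^~ y);
  lie_linearr : forall x, linear (lie x);
  liexx : forall x, lie x x = 0;
  lie_jacobi : forall x y z,
    lie x (lie y z) + lie y (lie z x) + lie z (lie x y) = 0
}.

#[short(type="lieAlgType")]
HB.structure Definition LieAlgebra (k : fieldType) :=
  { L of GRing.Lmodule k L & isLieAlgebra k L }.

HB.mixin Record hasOperator (k : fieldType) L of GRing.Lmodule k L := {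
  lop : L -> L;
  lop_linear : linear lop
}.

#[short(type="opLieAlgType")]
HB.structure Definition OpLieAlgebra (k : fieldType) :=
  { L of LieAlgebra k L & hasOperator k L }.

Record opLie_morphism (k : fieldType) (L M : opLieAlgType k) (f : L -> M) :
    Prop := OpLieMorphism {
  opLie_morphism_linear : linear f;
  opLie_morphism_lie : {morph f : a b / lie a b};
  opLie_morphism_op : {morph f : a / lop a}
}.

Definition free_opLie (k : fieldType) (X : Type) (F : opLieAlgType k)
    (i : X -> F) : Prop :=
  forall (L : opLieAlgType k) (f : X -> L),
    exists phi : F -> L,
      [/\ opLie_morphism phi, forall x, phi (i x) = f x
        & forall psi : F -> L,
            opLie_morphism psi -> (forall x, psi (i x) = f x) -> psi =1 phi].

Definition lext (k : fieldType) (K : choiceType) (V : lmodType k) (f : K -> V)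
    (a : {malg k[K]}) : V :=
  \sum_(u <- msupp a) a@_u *: f u.

Lemma lextEw (k : fieldType) (K : choiceType) (V : lmodType k) (f : K -> V)
    (d : {fset K}) (a : {malg k[K]}) :
  (msupp a `<=` d)%fset -> lext f a = \sum_(u <- d) a@_u *: f u.
Proof.
move=> le_d; rewrite /lext (big_fset_incl _ le_d) // => u _ un.
by rewrite mcoeff_outdom ?scale0r.
Qed.

Lemma lext_linear (k : fieldType) (K : choiceType) (V : lmodType k)
  (f : K -> V) : linear (lext f).
Proof.
move=> c a b; set d := (msupp (c *: a + b) `|` (msupp a `|` msupp b))%fset.
rewrite !(@lextEw _ _ _ f d) /d ?fsubsetUl //; last 2 first.
- by rewrite fsubsetU // fsubsetUr orbT.
- by rewrite fsubsetU // fsubsetUl orbT.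
rewrite scaler_sumr -big_split /=; apply: eq_bigr => u _.
by rewrite mcoeffD mcoeffZ scalerDl scalerA.
Qed.

Lemma lextU (k : fieldType) (K : choiceType) (V : lmodType k) (f : K -> V) u :
  lext f << u >> = f u.
Proof.
by rewrite (@lextEw _ _ _ _ [fset u]%fset) ?msuppU_le // big_seq_fset1
  mcoeffUU scale1r.
Qed.

Lemma malg_linear_ext (k : fieldType) (K : choiceType) (V : lmodType k)
    (f g : {malg k[K]} -> V) :
  linear f -> linear g -> (forall u, f << u >> = g << u >>) -> f =1 g.
Proof.
have linE (h : {malg k[K]} -> V) : linear h -> h =1 lext (fun u => h << u >>).
  move=> lin_h a; have h0 : h 0 = 0.
    by apply: (addrI (h 0)); rewrite addr0 -{1}[h 0]scale1r -lin_h scale1r addr0.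
  rewrite {1}(monalgE a) /lext; elim/big_rec2: _ => [|u y1 y2 _ <-] //.
  rewrite -lin_h; congr (h (_ + _)).
  by apply/malgP => v; rewrite mcoeffZ !mcoeffU mulrnAr mulr1.
by move=> lin_f lin_g fg a; rewrite (linE f) // (linE g) //;
  apply: eq_bigr => u _; rewrite fg.
Qed.

(* The family (e i), indexed by the i such that B i, is a basis of the
   subspace W: a finite linear combination of it is given by an element of
   {malg k[I]} with support in B. *)
Definition linear_basis (k : fieldType) (V : lmodType k) (I : choiceType)
    (B : I -> Prop) (e : I -> V) (W : V -> Prop) : Prop :=
  [/\ forall i, B i -> W (e i),
      forall c : {malg k[I]},
        (forall i, i \in msupp c -> B i) -> lext e c = 0 -> c = 0
    & forall a, W a ->
        exists2 c : {malg k[I]}, forall i, i \in msupp c -> B i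
                               & a = lext e c].

(* The union of the stages S(X)_n, as an inductive type: S(X)_n consists of
   the words of bracket depth at most n. *)
Inductive bword (X : Type) : Type :=
| BOne of bprime X
| BCons of bprime X & bword X
with bprime (X : Type) : Type :=
| BVar of X
| BBrack of bword X.

(* Classical equality and choice, so that the alphabet can be any type. *)
HB.instance Definition _ (X : Type) := gen_eqMixin (bword X).
HB.instance Definition _ (X : Type) := gen_choiceMixin (bword X).
HB.instance Definition _ (X : Type) := gen_eqMixin (bprime X).
HB.instance Definition _ (X : Type) := gen_choiceMixin (bprime X).

Fixpoint primes_of (X : Type) (w : bword X) : seq (bprime X) :=
  match w with
  | BOne p => [:: p]
  | BCons p w' => p :: primes_of w'
  end.

Fixpoint bmul (X : Type) (u v : bword X) : bword X :=
  match u with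
  | BOne p => BCons p v
  | BCons p u' => BCons p (bmul u' v)
  end.

Lemma bmulA (X : Type) : associative (@bmul X).
Proof. by elim=> [p|p u IHu] v w //=; rewrite IHu. Qed.

(* Words with a star are words on option X, None being the star. *)
Fixpoint nstar (X : Type) (q : bword (option X)) : nat :=
  match q with
  | BOne p => nstar_prime p
  | BCons p q' => nstar_prime p + nstar q'
  end%N
with nstar_prime (X : Type) (p : bprime (option X)) : nat :=
  match p with
  | BVar x => if x is None then 1%N else 0%N
  | BBrack q => nstar q
  end.

Fixpoint bsubst (X : Type) (u : bword X) (q : bword (option X)) : bword X :=
  match q with
  | BOne p => bsubst_prime u p
  | BCons p q' => bmul (bsubst_prime u p) (bsubst u q')
  end
with bsubst_prime (X : Type) (u : bword X) (p : bprime (option X)) : bword X :=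
  match p with
  | BVar None => u
  | BVar (Some x) => BOne (BVar x)
  | BBrack q => BOne (BBrack (bsubst u q))
  end.

Definition strict (T : eqType) (ge : rel T) : rel T :=
  fun u v => ge u v && (u != v).

(* Unlike in the dictionary order, a proper prefix is larger. *)
Fixpoint lex_gt (A : eqType) (gt : rel A) (u v : seq A) : bool :=
  match u, v with
  | _, [::] => false
  | [::], _ :: _ => true
  | x :: u', y :: v' => gt x y || (x == y) && lex_gt gt u' v'
  end.

Definition lex_ge (A : eqType) (gt : rel A) (u v : seq A) : bool :=
  (u == v) || lex_gt gt u v.

(* [well_order] is about minima, so it takes the relation "at most". *)
Definition monomial_order (X : Type) (ge : rel (bword X)) : Prop :=
  well_order (fun u v => ge v u) /\
  forall (q : bword (option X)) (u v : bword X), nstar q = 1%N ->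
    strict ge u v -> strict ge (bsubst u q) (bsubst v q).

Definition prime_gt (X : Type) (ge : rel (bword X)) : rel (bprime X) :=
  fun p q => strict ge (BOne p) (BOne q).

Definition invariant_order (X : Type) (ge : rel (bword X)) : Prop :=
  forall u v : bword X, perm_eq (primes_of u) (primes_of v) ->
    ge u v = lex_ge (prime_gt ge) (primes_of u) (primes_of v).

Definition invariant_monomial_order (X : Type) (ge : rel (bword X)) : Prop :=
  monomial_order ge /\ invariant_order ge.

Definition ALSW (A : eqType) (gt : rel A) (w : seq A) : Prop :=
  w <> [::] /\
  forall u v : seq A, u <> [::] -> v <> [::] -> w = u ++ v ->
    lex_gt gt (u ++ v) (v ++ u).

Inductive naword (A : Type) : Type :=
| NALeaf of A
| NANode of naword A & naword A.

Fixpoint naleaves (A : Type) (t : naword A) : seq A :=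
  match t with
  | NALeaf x => [:: x]
  | NANode l r => naleaves l ++ naleaves r
  end.

Fixpoint NLSW (A : eqType) (gt : rel A) (t : naword A) : Prop :=
  ALSW gt (naleaves t) /\
  match t with
  | NALeaf _ => True
  | NANode l r =>
      [/\ NLSW gt l, NLSW gt r
        & match l with
          | NALeaf _ => True
          | NANode _ l2 => lex_ge gt (naleaves r) (naleaves l2)
          end]
  end.

Fixpoint ALSBW_stage (X : Type) (ge : rel (bword X)) (n : nat) (w : bword X) :
    Prop :=
  ALSW (prime_gt ge) (primes_of w) /\
  forall p, p \in primes_of w ->
    match p, n with
    | BVar _, _ => True
    | BBrack _, 0%N => False
    | BBrack w', m.+1 => ALSBW_stage ge m w'
    end.

Definition ALSBW (X : Type) (ge : rel (bword X)) (w : bword X) : Prop :=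
  exists n, ALSBW_stage ge n w.

Inductive nabword (X : Type) : Type :=
| NVar of X
| NBrack of nabword X
| NMul of nabword X & nabword X.

HB.instance Definition _ (X : Type) := gen_eqMixin (nabword X).
HB.instance Definition _ (X : Type) := gen_choiceMixin (nabword X).

(* [bracketing ge w t] means t = [w].  The letters [w_i], ordered as the w_i,
   are represented by the w_i in the Lyndon-Shirshov tree s on the primes of
   w, and [bracketing_tree ge s t] replaces each leaf w_i of s by [w_i]. *)
Inductive bracketing (X : Type) (ge : rel (bword X)) :
    bword X -> nabword X -> Prop :=
| BracketingWord w s t :
    NLSW (prime_gt ge) s -> naleaves s = primes_of w ->
    bracketing_tree ge s t -> bracketing ge w t
with bracketing_tree (X : Type) (ge : rel (bword X)) :
    naword (bprime X) -> nabword X -> Prop :=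
| BracketingVar x : bracketing_tree ge (NALeaf (BVar x)) (NVar x)
| BracketingBrack w t :
    bracketing ge w t -> bracketing_tree ge (NALeaf (BBrack w)) (NBrack t)
| BracketingNode s1 s2 t1 t2 :
    bracketing_tree ge s1 t1 -> bracketing_tree ge s2 t2 ->
    bracketing_tree ge (NANode s1 s2) (NMul t1 t2).

Definition NLSBW (X : Type) (ge : rel (bword X)) (t : nabword X) : Prop :=
  exists2 w, ALSBW ge w & bracketing ge w t.

Definition bwalg (k : fieldType) (X : Type) : Type := {malg k[bword X]}.

HB.instance Definition _ (k : fieldType) (X : Type) :=
  GRing.Lmodule.copy (bwalg k X) {malg k[bword X]}.

Definition bw_mul (k : fieldType) (X : Type) (a b : bwalg k X) : bwalg k X :=
  lext (fun u => lext (fun v => << bmul u v >> : bwalg k X) b) a.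

Definition bw_op (k : fieldType) (X : Type) (a : bwalg k X) : bwalg k X :=
  lext (fun w => << BOne (BBrack w) >> : bwalg k X) a.

Definition bw_lie (k : fieldType) (X : Type) (a b : bwalg k X) : bwalg k X :=
  bw_mul a b - bw_mul b a.

Definition bw_var (k : fieldType) (X : Type) (x : X) : bwalg k X :=
  << BOne (BVar x) >>.

Lemma bw_mul_linearl (k : fieldType) (X : Type) (b : bwalg k X) :
  linear ((@bw_mul k X)^~ b).
Proof. exact: lext_linear. Qed.

Lemma bw_mul_linearr (k : fieldType) (X : Type) (a : bwalg k X) :
  linear (bw_mul a).
Proof.
move=> c b b'; rewrite /bw_mul.
rewrite {1 3 5}/lext scaler_sumr -big_split /=.
apply: eq_bigr => u _; rewrite lext_linear.
by rewrite scalerDr !scalerA mulrC.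
Qed.

Lemma bw_mulBl (k : fieldType) (X : Type) (a b c : bwalg k X) :
  bw_mul (a - b) c = bw_mul a c - bw_mul b c.
Proof. by rewrite addrC -scaleN1r bw_mul_linearl scaleN1r addrC. Qed.

Lemma bw_mulBr (k : fieldType) (X : Type) (a b c : bwalg k X) :
  bw_mul a (b - c) = bw_mul a b - bw_mul a c.
Proof. by rewrite addrC -scaleN1r bw_mul_linearr scaleN1r addrC. Qed.

Lemma bw_mulUU (k : fieldType) (X : Type) (u v : bword X) :
  bw_mul (<< u >> : bwalg k X) << v >> = << bmul u v >>.
Proof. by rewrite /bw_mul !lextU. Qed.

Lemma bw_mulA (k : fieldType) (X : Type) : associative (@bw_mul k X).
Proof.
move=> a b c; move: a.
apply: malg_linear_ext => [|d a a'|u]; first exact: bw_mul_linearl.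
  by rewrite !bw_mul_linearl.
move: b; apply: malg_linear_ext => [d b b'|d b b'|v].
- by rewrite bw_mul_linearl bw_mul_linearr.
- by rewrite bw_mul_linearr bw_mul_linearl.
move: c; apply: malg_linear_ext => [d c c'||w]; last by rewrite !bw_mulUU bmulA.
  by rewrite !bw_mul_linearr.
exact: bw_mul_linearr.
Qed.

Lemma bw_op_linear (k : fieldType) (X : Type) : linear (@bw_op k X).
Proof. exact: lext_linear. Qed.

Lemma bw_lie_linearl (k : fieldType) (X : Type) (b : bwalg k X) :
  linear ((@bw_lie k X)^~ b).
Proof.
move=> c a a'; rewrite /bw_lie bw_mul_linearl bw_mul_linearr.
by rewrite opprD addrACA -scalerBr.
Qed.

Lemma bw_lie_linearr (k : fieldType) (X : Type) (a : bwalg k X) :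
  linear (bw_lie a).
Proof.
move=> c b b'; rewrite /bw_lie bw_mul_linearl bw_mul_linearr.
by rewrite opprD addrACA -scalerBr.
Qed.

Lemma bw_liexx (k : fieldType) (X : Type) (a : bwalg k X) : bw_lie a a = 0.
Proof. exact: subrr. Qed.

Lemma commutator_jacobi (V : zmodType) (mul : V -> V -> V) :
  (forall a b c, mul (a - b) c = mul a c - mul b c) ->
  (forall a b c, mul a (b - c) = mul a b - mul a c) ->
  associative mul ->
  let br a b := mul a b - mul b a in
  forall a b c, br a (br b c) + br b (br c a) + br c (br a b) = 0.
Proof.
move=> mulBl mulBr mulA br a b c; rewrite /br !mulBl !mulBr !mulA.
have swap (x y z t : V) : x - y - (z - t) = (x - z) + (t - y).
  by rewrite opprB addrACA [- y + _]addrC -addrACA addrACA.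
have add3 (x1 y1 x2 y2 x3 y3 : V) :
  x1 + y1 + (x2 + y2) + (x3 + y3) = (x1 + x2 + x3) + (y1 + y2 + y3).
  by rewrite (addrACA x1) (addrACA (x1 + x2)).
have cycle (x y z : V) : x - y + (y - z) + (z - x) = 0.
  by rewrite subrKA addrC subrKA subrr.
rewrite !swap add3 cycle add0r.
exact: cycle.
Qed.

Lemma bw_lie_jacobi (k : fieldType) (X : Type) (a b c : bwalg k X) :
  bw_lie a (bw_lie b c) + bw_lie b (bw_lie c a) + bw_lie c (bw_lie a b) = 0.
Proof.
by apply: commutator_jacobi; [exact: bw_mulBl|exact: bw_mulBr|exact: bw_mulA].
Qed.

HB.instance Definition _ (k : fieldType) (X : Type) :=
  isLieAlgebra.Build k (bwalg k X) (@bw_lie_linearl k X) (@bw_lie_linearr k X)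
    (@bw_liexx k X) (@bw_lie_jacobi k X).
HB.instance Definition _ (k : fieldType) (X : Type) :=
  hasOperator.Build k (bwalg k X) (@bw_op_linear k X).

Fixpoint nab_eval (k : fieldType) (X : Type) (t : nabword X) : bwalg k X :=
  match t with
  | NVar x => bw_var k x
  | NBrack t => bw_op (nab_eval k t)
  | NMul t1 t2 => bw_lie (nab_eval k t1) (nab_eval k t2)
  end.

Inductive OLie (k : fieldType) (X : Type) : bwalg k X -> Prop :=
| OLieVar x : OLie (bw_var k x)
| OLie0 : OLie 0
| OLieLin (c : k) a b : OLie a -> OLie b -> OLie (c *: a + b)
| OLieLie a b : OLie a -> OLie b -> OLie (bw_lie a b)
| OLieOp a : OLie a -> OLie (bw_op a).

Definition OLie_pred (k : fieldType) (X : Type) : {pred bwalg k X} :=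
  fun a => `[< OLie a >].

Arguments OLie_pred : clear implicits.

Lemma OLieP (k : fieldType) (X : Type) (a : bwalg k X) :
  reflect (OLie a) (a \in OLie_pred k X).
Proof. exact: asboolP. Qed.

Lemma OLie_submod_closed (k : fieldType) (X : Type) :
  submod_closed (OLie_pred k X).
Proof.
split=> [|c a b /OLieP Oa /OLieP Ob]; apply/OLieP; first exact: OLie0.
exact: OLieLin.
Qed.

HB.instance Definition _ (k : fieldType) (X : Type) :=
  GRing.isSubmodClosed.Build k (bwalg k X) (OLie_pred k X)
    (OLie_submod_closed k X).

Record olie (k : fieldType) (X : Type) : Type := OLieElt {
  olie_val : bwalg k X;
  olie_valP : olie_val \in OLie_pred k X
}.

HB.instance Definition _ (k : fieldType) (X : Type) :=
  [isSub for @olie_val k X].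
HB.instance Definition _ (k : fieldType) (X : Type) :=
  [Choice of olie k X by <:].
HB.instance Definition _ (k : fieldType) (X : Type) :=
  [SubChoice_isSubLmodule of olie k X by <:].

Lemma OLie_lie_subproof (k : fieldType) (X : Type) (a b : olie k X) :
  bw_lie (olie_val a) (olie_val b) \in OLie_pred k X.
Proof. by apply/OLieP/OLieLie; apply/OLieP/olie_valP. Qed.

Lemma OLie_op_subproof (k : fieldType) (X : Type) (a : olie k X) :
  bw_op (olie_val a) \in OLie_pred k X.
Proof. by apply/OLieP/OLieOp/OLieP/olie_valP. Qed.

Lemma OLie_var_subproof (k : fieldType) (X : Type) (x : X) :
  bw_var k x \in OLie_pred k X.
Proof. exact/OLieP/OLieVar. Qed.

Definition olie_lie (k : fieldType) (X : Type) (a b : olie k X) : olie k X :=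
  OLieElt (OLie_lie_subproof a b).

Definition olie_op (k : fieldType) (X : Type) (a : olie k X) : olie k X :=
  OLieElt (OLie_op_subproof a).

Definition olie_var (k : fieldType) (X : Type) (x : X) : olie k X :=
  OLieElt (OLie_var_subproof k x).

Lemma olie_lie_linearl (k : fieldType) (X : Type) (b : olie k X) :
  linear ((@olie_lie k X)^~ b).
Proof. by move=> c a a'; apply: val_inj; apply: bw_lie_linearl. Qed.

Lemma olie_lie_linearr (k : fieldType) (X : Type) (a : olie k X) :
  linear (olie_lie a).
Proof. by move=> c b b'; apply: val_inj; apply: bw_lie_linearr. Qed.

Lemma olie_liexx (k : fieldType) (X : Type) (a : olie k X) : olie_lie a a = 0.
Proof. by apply: val_inj; apply: bw_liexx. Qed.

Lemma olie_lie_jacobi (k : fieldType) (X : Type) (a b c : olie k X) :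
  olie_lie a (olie_lie b c) + olie_lie b (olie_lie c a)
    + olie_lie c (olie_lie a b) = 0.
Proof. by apply: val_inj; apply: bw_lie_jacobi. Qed.

Lemma olie_op_linear (k : fieldType) (X : Type) : linear (@olie_op k X).
Proof. by move=> c a b; apply: val_inj; apply: bw_op_linear. Qed.

HB.instance Definition _ (k : fieldType) (X : Type) :=
  isLieAlgebra.Build k (olie k X) (@olie_lie_linearl k X)
    (@olie_lie_linearr k X) (@olie_liexx k X) (@olie_lie_jacobi k X).
HB.instance Definition _ (k : fieldType) (X : Type) :=
  hasOperator.Build k (olie k X) (@olie_op_linear k X).

(* Main.v *)
Require Import Defs.
From HB Require Import structures.
From mathcomp Require Import all_boot all_algebra finmap monalg.
From mathcomp Require Import boolp wochoice.

(* Every element of OLie(X) is a combination of bracketed Lyndon-Shirshov words,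
   and the rewriting that shows it is valid in every operated Lie algebra: if
   the bracketing of uv is not a Lyndon-Shirshov one then u = u1 u2 and the
   Jacobi identity moves v inside u.  On the other hand the leading word of
   [w] in the semigroup algebra is w with coefficient 1 (the order is monomial,
   and by invariance uv > vu for a Lyndon-Shirshov word uv), so the NLSBW(X)
   are linearly independent.  A map from X to an operated Lie algebra L thus
   extends linearly along the basis, and the extension respects brackets
   because the coefficients of the rewriting do not depend on L. *)

Set Implicit Arguments.
Unset Strict Implicit.
Unset Printing Implicit Defensive.

Import GRing.Theory.
Local Open Scope ring_scope.

(** * Lyndon-Shirshov words and the uniqueness of their bracketing *)

Lemma cat_split (T : Type) (u v x s : seq T) :
  u ++ v = x ++ s ->
  (exists y, x = u ++ y /\ v = y ++ s) \/
  (exists y, [/\ y <> [::], u = x ++ y & s = y ++ v]).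
Proof.
elim: u x => [|a u IHu] x /= E; first by left; exists x.
case: x E => [|b x] /= E; first by right; exists (a :: u).
case: E => -> /IHu[[y [-> ->]]|[y [y0 -> ->]]]; first by left; exists y.
by right; exists y.
Qed.

Section LyndonWords.
Variables (A : eqType) (gt : rel A).
Hypotheses (gt_irr : irreflexive gt) (gt_trans : transitive gt).
Hypothesis gt_total : forall x y, x != y -> gt x y || gt y x.
(* [lex u v] is the usual dictionary order "u comes before v" for the reversed
   alphabet: a proper prefix comes first. *)
Local Notation lex := (lex_gt gt).
Implicit Types u v w x : seq A.

Lemma lex_irr : irreflexive lex.
Proof. by elim=> //= a u ->; rewrite gt_irr eqxx. Qed.

Lemma lex_trans : transitive lex.
Proof.
elim=> [|b v IHv] [|a u] [|c w] //=.
case/orP=> [ab|/andP[/eqP-> uv]]; case/orP=> [bc|/andP[/eqP<- vw]].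
- by rewrite (gt_trans ab bc).
- by rewrite ab.
- by rewrite bc.
- by rewrite eqxx (IHv _ _ uv vw) orbT.
Qed.

Lemma lex_total u v : u != v -> lex u v || lex v u.
Proof.
elim: u v => [|a u IHu] [|b v] //=.
rewrite eqseq_cons; have [<-|neq_ab _] := eqVneq a b.
  by rewrite gt_irr => /IHu.
by case/orP: (gt_total neq_ab) => ->; rewrite ?orbT.
Qed.

Lemma lex_asym u v : lex u v -> lex v u = false.
Proof. by move=> uv; apply/negP => /(lex_trans uv); rewrite lex_irr. Qed.

Lemma lex_cat2l x u v : lex (x ++ u) (x ++ v) = lex u v.
Proof. by elim: x => //= a x ->; rewrite gt_irr eqxx. Qed.

Lemma lex_prefix u v : v != [::] -> lex u (u ++ v).
Proof. by move=> v0; rewrite -{1}[u]cats0 lex_cat2l; case: v v0. Qed.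

Lemma lex_cat u v x y : lex u v -> ~~ prefix u v -> lex (u ++ x) (v ++ y).
Proof.
elim: u v => [|a u IHu] [|b v] //=.
case/orP=> [-> //|/andP[/eqP-> uv]].
by rewrite eqxx /= => /(IHu _ uv)->; rewrite orbT.
Qed.

Lemma lex_catW u v x : lex u v -> lex u (v ++ x).
Proof.
have [->|x0] := eqVneq x [::]; first by rewrite cats0.
by move=> uv; apply: lex_trans uv (lex_prefix _ x0).
Qed.

Lemma lex_cat_size u v x y :
  size u = size v -> lex u v -> lex (u ++ x) (v ++ y).
Proof.
move=> suv uv; apply: lex_cat => //; apply/prefixP => -[z vE].
move: uv suv; rewrite vE size_cat => + /eqP.
rewrite -{1}[size u]addn0 eqn_add2l; case: z {vE} => //.
by rewrite cats0 lex_irr.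
Qed.

(** For the direct implication, a proper suffix [v] coming before [uv] would be a prefix of it, say
    [uv = vu']. Then [uv] before [vu] gives [u'] before [u], and [vu'], [u'v], [uv] form a cycle. *)
Lemma ALSW_suffixP w :
  ALSW gt w <->
  w <> [::] /\
  forall u v, u <> [::] -> v <> [::] -> w = u ++ v -> lex (u ++ v) v.
Proof.
split=> -[w0 wP]; split=> // u v u0 v0 wE; last exact/lex_catW/(wP u v).
case vu : (lex v (u ++ v)); last first.
  have /lex_total : u ++ v != v.
    by apply/eqP => /(congr1 size)/eqP; rewrite size_cat -{2}[size v]add0n
      eqn_add2r size_eq0 => /eqP.
  by rewrite vu orbF.
have /prefixP[u' uvE] : prefix v (u ++ v).
  apply/negPn/negP => /(lex_cat u [::] vu); rewrite cats0 => vuv.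
  by move: (wP _ _ u0 v0 wE); rewrite (lex_asym vuv).
have su : size u' = size u.
  by move/(congr1 size)/eqP: uvE; rewrite !size_cat addnC eqn_add2l => /eqP.
have u'0 : u' <> [::].
  by move=> u'E; apply: u0; apply/size0nil; rewrite -su u'E.
have h1 : lex (v ++ u') (v ++ u) by rewrite -uvE; apply: wP.
rewrite lex_cat2l in h1.
have := lex_trans (wP _ _ v0 u'0 (etrans wE uvE)) (lex_cat_size v v su h1).
by rewrite uvE lex_irr.
Qed.

(** By the suffix criterion: a suffix starting inside [u] already differs from [u] at a letter, [u]
    being too long to be its prefix, and a suffix of [v] is [v] or comes after it, hence comes after
    [uv]. *)
Lemma ALSW_cat u v : ALSW gt u -> ALSW gt v -> lex u v -> ALSW gt (u ++ v).
Proof.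
move=> /ALSW_suffixP[u0 uP] /ALSW_suffixP[v0 vP] uv.
have uv_v : lex (u ++ v) v.
  have [/prefixP[v' vE]|npre] := boolP (prefix u v); last first.
    by rewrite -[X in lex _ X]cats0; apply: lex_cat.
  rewrite {2}vE lex_cat2l {1}vE; apply: (vP u) => // v'0.
  by move: uv; rewrite vE v'0 cats0 lex_irr.
apply/ALSW_suffixP; split=> [|x s x0 s0 E]; first by case: (u) u0.
rewrite -E; case: (cat_split E) => -[y]; last first.
  move=> [y0 uE ->]; apply: lex_cat; first by rewrite uE; apply: (uP x).
  apply/negP => /size_prefix.
  by rewrite uE size_cat -{2}[size y]add0n leq_add2r leqn0 size_eq0 => /eqP.
move=> [_ vE]; have [y0|/eqP y0] := eqVneq y [::].
  by move: vE; rewrite y0 /= => <-.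
by apply: lex_trans uv_v _; rewrite {1}vE; apply: (vP y).
Qed.

Local Notation leaves := (@naleaves A).

Lemma NLSW_ALSW t : NLSW gt t -> ALSW gt (leaves t).
Proof. by case: t => [a|l r] []. Qed.

Lemma naleaves_neq0 (t : naword A) : leaves t <> [::].
Proof. by elim: t => //= l IHl r _; case: (leaves l) IHl. Qed.

Lemma lex_ge_trans : transitive (lex_ge gt).
Proof.
move=> v u w /orP[/eqP->//|uv] /orP[/eqP<-|vw].
  by rewrite /lex_ge uv orbT.
by rewrite /lex_ge (lex_trans uv vw) orbT.
Qed.

(* Hence the underlying word determines the root split. *)
Lemma NLSW_right_minimal l r x s :
  NLSW gt (NANode l r) -> x <> [::] -> s <> [::] ->
  leaves l ++ leaves r = x ++ s -> lex_ge gt (leaves r) s.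
Proof.
elim: l r x s => [a|a IHa b _] r x s /= [_ [nl nr lr]] x0 s0.
  case: x x0 => // c [|d x] _ [_]; first by move=> ->; rewrite /lex_ge eqxx.
  rewrite -cat_cons => rE.
  have /ALSW_suffixP[_ /(_ (d :: x) s)] := NLSW_ALSW nr.
  by rewrite /lex_ge -rE => -> //; rewrite orbT.
case/cat_split => -[y].
  move=> [_ rE]; have [y0|/eqP y0] := eqVneq y [::].
    by rewrite rE y0 /lex_ge eqxx.
  have /ALSW_suffixP[_ /(_ _ _ y0 s0 rE)] := NLSW_ALSW nr.
  by rewrite -rE /lex_ge => ->; rewrite orbT.
(* The suffix starts inside the left factor: [leaves r] is weakly before [leaves b] by the third
   condition on trees, [leaves b] before [y] by induction, and [y] is a prefix of the suffix. *)
move=> [y0 /(IHa _ _ _ nl x0 y0) by_ ->].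
apply: (lex_ge_trans lr); apply: (lex_ge_trans by_).
by rewrite /lex_ge lex_prefix ?orbT //; apply/eqP/naleaves_neq0.
Qed.

(** Both right factors are suffixes of the common word, so by minimality neither strictly precedes
    the other; the root splits agree and induction applies to the factors. *)
Lemma NLSW_inj t1 t2 :
  NLSW gt t1 -> NLSW gt t2 -> leaves t1 = leaves t2 -> t1 = t2.
Proof.
elim: t1 t2 => [a|l1 IHl r1 IHr] [b|l2 r2] n1 n2 /=.
- by case=> ->.
- by case: (leaves l2) (@naleaves_neq0 l2) => // c s _ [_];
    case: s => //; case: (leaves r2) (@naleaves_neq0 r2).
- by case: (leaves l1) (@naleaves_neq0 l1) => // c s _ [_];
    case: s => //; case: (leaves r1) (@naleaves_neq0 r1).
move=> E; have rE : leaves r1 = leaves r2.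
  have:= NLSW_right_minimal n1 (@naleaves_neq0 l2) (@naleaves_neq0 r2) E.
  have:= NLSW_right_minimal n2 (@naleaves_neq0 l1) (@naleaves_neq0 r1) (esym E).
  rewrite /lex_ge => /orP[/eqP->//|r21] /orP[/eqP//|].
  by rewrite (lex_asym r21).
have lE : leaves l1 = leaves l2.
  move/eqP: (E); rewrite eqseq_cat ?rE => [/andP[/eqP] //|].
  by apply/eqP; move/(congr1 size)/eqP: E; rewrite !size_cat rE eqn_add2r.
case: n1 n2 => _ [nl1 nr1 _] [_ [nl2 nr2 _]].
by congr NANode; [apply: IHl|apply: IHr].
Qed.

(** The dictionary order need not be well founded on all words. As a termination measure, a word is
    ranked by the number of words of this finite list that precede it. *)
Fixpoint bounded_words (D : seq A) n : seq (seq A) :=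
  if n is m.+1 then [::] :: [seq a :: w | a <- D, w <- bounded_words D m]
  else [:: [::]].

Lemma mem_bounded_words (D : seq A) n w :
  (size w <= n)%N -> {subset w <= D} -> w \in bounded_words D n.
Proof.
elim: n w => [|n IHn] [|a w] //= sw wD.
apply/allpairsP; exists (a, w); split=> //=.
  by apply: wD; rewrite inE eqxx.
by apply: IHn => // b bw; apply: wD; rewrite inE bw orbT.
Qed.

Lemma count_lex_lt (W : seq (seq A)) u v :
  u \in W -> lex u v -> (count (lex^~ u) W < count (lex^~ v) W)%N.
Proof.
move=> uW uv; have -> : count (lex^~ v) W =
    (count (lex^~ u) W + count (predI (predC (lex^~ u)) (lex^~ v)) W)%N.
  elim: W {uW} => //= w W ->; rewrite addnACA; congr (_ + _)%N.
  by case wu : (lex w u) => //=; rewrite (lex_trans wu uv).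
rewrite -[X in (X < _)%N]addn0 ltn_add2l -has_count.
by apply/hasP; exists u => //=; rewrite lex_irr uv.
Qed.

End LyndonWords.

(** * Linear extension and supports of formal combinations *)

Section LinearExtension.
Variables (k : fieldType) (K : choiceType).
Implicit Types (S T : K -> Prop) (a b : {malg k[K]}).

Definition supp_in S a : Prop := forall i, i \in msupp a -> S i.

Lemma supp_in0 S : supp_in S 0.
Proof. by move=> i; rewrite msupp0 inE. Qed.

Lemma supp_in_lin S c a b :
  supp_in S a -> supp_in S b -> supp_in S (c *: a + b).
Proof.
move=> Sa Sb i /(fsubsetP (msuppD_le _ _)); rewrite inE => /orP[|/Sb//].
by move/(fsubsetP (msuppZ_le _ _))/Sa.
Qed.

Lemma supp_inD S a b : supp_in S a -> supp_in S b -> supp_in S (a + b).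
Proof. by rewrite -{2}[a]scale1r; apply: supp_in_lin. Qed.

Lemma supp_inB S a b : supp_in S a -> supp_in S b -> supp_in S (a - b).
Proof. by move=> Sa Sb; rewrite addrC -scaleN1r; apply: supp_in_lin. Qed.

Lemma supp_inU S i : S i -> supp_in S (<< i >> : {malg k[K]}).
Proof. by move=> Si j /(fsubsetP msuppU_le); rewrite inE => /eqP->. Qed.

Lemma supp_inW S T a : (forall i, S i -> T i) -> supp_in S a -> supp_in T a.
Proof. by move=> ST Sa i /Sa/ST. Qed.

Lemma linear_0 (V W : lmodType k) (h : V -> W) : linear h -> h 0 = 0.
Proof.
by move=> lin_h; rewrite -[0](addNr 0) -scaleN1r lin_h scaleN1r addNr.
Qed.

Lemma linear_D (V W : lmodType k) (h : V -> W) :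
  linear h -> {morph h : a b / a + b}.
Proof. by move=> lin_h a b; rewrite -{1}[a]scale1r lin_h scale1r. Qed.

Lemma linear_N (V W : lmodType k) (h : V -> W) :
  linear h -> {morph h : a / - a}.
Proof.
by move=> lin_h a; rewrite -[- a]addr0 -scaleN1r lin_h (linear_0 lin_h) addr0
  scaleN1r.
Qed.

Lemma linear_lext (V W : lmodType k) (h : V -> W) (f : K -> V) a :
  linear h -> h (lext f a) = lext (fun i => h (f i)) a.
Proof.
move=> lin_h; move: a; apply: malg_linear_ext => [c a b||i].
- by rewrite lext_linear lin_h.
- exact: lext_linear.
- by rewrite !lextU.
Qed.

Lemma eq_lext (V : lmodType k) (f g : K -> V) S a :
  supp_in S a -> (forall i, S i -> f i = g i) -> lext f a = lext g a.
Proof.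
move=> Sa fg; rewrite /lext 2!big_seq; apply: eq_bigr => i ia.
by rewrite fg //; apply: Sa.
Qed.

Lemma lext_mem (V : lmodType k) (P : V -> Prop) (f : K -> V) S a :
  P 0 -> (forall c x y, P x -> P y -> P (c *: x + y)) ->
  (forall i, S i -> P (f i)) -> supp_in S a -> P (lext f a).
Proof.
move=> P0 Plin Pf Sa; rewrite /lext big_seq.
elim/big_rec: _ => // i x ia Px; apply: Plin => //; exact/Pf/Sa.
Qed.

End LinearExtension.

Lemma lext_lext (k : fieldType) (K K' : choiceType) (V : lmodType k)
    (f : K' -> V) (h : K -> {malg k[K']}) (a : {malg k[K]}) :
  lext f (lext h a) = lext (fun i => lext f (h i)) a.
Proof. exact/linear_lext/lext_linear. Qed.

Lemma supp_in_lext (k : fieldType) (K K' : choiceType) (S : K -> Prop)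
    (T : K' -> Prop) (h : K -> {malg k[K']}) (a : {malg k[K]}) :
  supp_in S a -> (forall i, S i -> supp_in T (h i)) -> supp_in T (lext h a).
Proof.
move=> Sa hT; apply: (@lext_mem _ _ _ _ _ S) => //; first exact: supp_in0.
by move=> c x y; apply: supp_in_lin.
Qed.

(** * Lie identities and combinations uniform over a family of Lie algebras *)

Section LieIdentities.
Variables (k : fieldType) (L : lieAlgType k).
Implicit Types a b c : L.

Lemma lie_antisym a b : lie a b = - lie b a.
Proof.
apply/eqP; rewrite -addr_eq0; apply/eqP; rewrite -(liexx (a + b)).
rewrite (linear_D (lie_linearl _)) !(linear_D (lie_linearr _)) !liexx.
by rewrite add0r addr0.
Qed.

(** The form of the Jacobi identity that moves [c] inside the bracket of [a] and [b]. *)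
Lemma lie_leibniz a b c : lie (lie a b) c = lie (lie a c) b + lie a (lie b c).
Proof.
rewrite [lie (lie a b) c]lie_antisym [lie (lie a c) b]lie_antisym.
rewrite [lie a c]lie_antisym (linear_N (lie_linearr _)) opprK.
by apply/eqP; rewrite eq_sym -addr_eq0 [lie b _ + _]addrC lie_jacobi.
Qed.

End LieIdentities.

(* [m : M] ranges over Lie algebras [L m] in which the elements of [K] are
   interpreted; the combination [c] must be the same in all of them. *)
Section UniformCombinations.
Variables (k : fieldType) (K : choiceType) (M : Type) (L : M -> lieAlgType k).
Variable e : forall m, K -> L m.
Implicit Types (S T U : K -> Prop) (F G : forall m, L m).

Definition uniform_comb S F : Prop :=
  exists2 c : {malg k[K]}, supp_in S c & forall m, F m = lext (@e m) c.

Lemma uniform_comb_eq S F G :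
  (forall m, F m = G m) -> uniform_comb S G -> uniform_comb S F.
Proof. by move=> FG [c Sc Gc]; exists c => // m; rewrite FG. Qed.

Lemma uniform_comb0 S : uniform_comb S (fun m => 0).
Proof.
by exists 0 => [|m]; [exact: supp_in0|rewrite (linear_0 (lext_linear _))].
Qed.

Lemma uniform_comb_lin S c F G : uniform_comb S F -> uniform_comb S G ->
  uniform_comb S (fun m => c *: F m + G m).
Proof.
move=> [a Sa Fa] [b Sb Gb]; exists (c *: a + b); first exact: supp_in_lin.
by move=> m; rewrite lext_linear Fa Gb.
Qed.

Lemma uniform_combD S F G : uniform_comb S F -> uniform_comb S G ->
  uniform_comb S (fun m => F m + G m).
Proof.
move=> SF SG; apply: uniform_comb_eq (uniform_comb_lin 1 SF SG) => m.
by rewrite scale1r.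
Qed.

Lemma uniform_combN S F : uniform_comb S F -> uniform_comb S (fun m => - F m).
Proof.
move=> SF; apply: uniform_comb_eq (uniform_comb_lin (-1) SF (uniform_comb0 S)).
by move=> m; rewrite scaleN1r addr0.
Qed.

Lemma uniform_combU S i : S i -> uniform_comb S (fun m => e m i).
Proof.
by move=> Si; exists << i >> => [|m]; [exact: supp_inU|rewrite lextU].
Qed.

Lemma uniform_combW S T F :
  (forall i, S i -> T i) -> uniform_comb S F -> uniform_comb T F.
Proof. by move=> ST [c Sc Fc]; exists c => //; apply: supp_inW Sc. Qed.

Lemma uniform_comb_lext (K' : choiceType) (S : K' -> Prop) T
    (h : forall m, K' -> L m) (c : {malg k[K']}) :
  supp_in S c -> (forall i, S i -> uniform_comb T (fun m => h m i)) ->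
  uniform_comb T (fun m => lext (h m) c).
Proof.
(* Induction on the finite support collects the combinations one at a time, without a choice
   function. *)
move=> Sc hT; suff sumP (s : seq K') : (forall j, j \in s -> S j) ->
    uniform_comb T (fun m => \sum_(i <- s) c@_i *: h m i) by exact: sumP Sc.
elim: s => [|i s IHs] Ss.
  by apply: uniform_comb_eq (uniform_comb0 T) => m; rewrite big_nil.
have Si : S i by apply: Ss; rewrite inE eqxx.
have {}IHs := IHs (fun j js => Ss j (mem_behead (s := i :: s) js)).
apply: uniform_comb_eq (uniform_comb_lin c@_i (hT i Si) IHs) => m.
by rewrite big_cons.
Qed.

Lemma uniform_comb_lie S T U F G :
  uniform_comb S F -> uniform_comb T G ->
  (forall i j, S i -> T j -> uniform_comb U (fun m => lie (e m i) (e m j))) ->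
  uniform_comb U (fun m => lie (F m) (G m)).
Proof.
move=> [c Sc Fc] [d Td Gd] STU.
suff /uniform_comb_eq : uniform_comb U
    (fun m => lext (fun i => lext (fun j => lie (e m i) (e m j)) d) c).
  apply=> m; rewrite Fc Gd (linear_lext (h := lie^~ _)); last first.
    exact: lie_linearl.
  by apply: (@eq_lext _ _ _ _ _ S) => // i _; exact/linear_lext/lie_linearr.
apply: (uniform_comb_lext Sc) => i Si; apply: (uniform_comb_lext Td) => j Tj.
exact: STU.
Qed.

End UniformCombinations.

(** * Brackets of two Lyndon-Shirshov trees in an arbitrary Lie algebra *)

HB.instance Definition _ (A : Type) := gen_eqMixin (naword A).
HB.instance Definition _ (A : Type) := gen_choiceMixin (naword A).

Fixpoint naeval (k : fieldType) (L : lieAlgType k) (A : Type) (g : A -> L)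
    (t : naword A) : L :=
  match t with
  | NALeaf a => g a
  | NANode l r => lie (naeval g l) (naeval g r)
  end.

Section LyndonBracket.
Variables (k : fieldType) (A : eqType) (gt : rel A).
Hypotheses (gt_irr : irreflexive gt) (gt_trans : transitive gt).
Hypothesis gt_total : forall x y, x != y -> gt x y || gt y x.
Local Notation lex := (lex_gt gt).
Local Notation leaves := (@naleaves A).
(** The family consists of all Lie algebras with all interpretations of the letters, so the
    coefficients can depend on the trees only. *)
Local Notation comb := (@uniform_comb k (naword A) {L : lieAlgType k & A -> L}
  (@projT1 _ _) (fun m => naeval (projT2 m))).

(* The Jacobi identity replaces the bracket of [(u1 u2)] and [v] by brackets
   of smaller total length, or of the same length and with a larger second
   entry; the latter stays among the finitely many words of bounded length
   in the letters of [D]. *)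
Lemma NLSW_lie_ordered (D : seq A) N n p s1 s2 :
  NLSW gt s1 -> NLSW gt s2 -> lex (leaves s1) (leaves s2) ->
  (size (leaves s1 ++ leaves s2) < n)%N ->
  (size (leaves s1 ++ leaves s2) <= N)%N ->
  {subset leaves s1 ++ leaves s2 <= D} ->
  (count (lex^~ (leaves s2)) (bounded_words D N) < p)%N ->
  comb (fun t => [/\ NLSW gt t, perm_eq (leaves t) (leaves s1 ++ leaves s2)
                   & lex (leaves t) (leaves s2)])
       (fun m => lie (naeval (projT2 m) s1) (naeval (projT2 m) s2)).
Proof.
(* Outer induction on the bound [n] of the length, inner one on the bound [p] of the rank of the
   second entry; [D] and [N] stay fixed so that all ranks refer to one list. *)
elim: n p s1 s2 => // n IHn; elim=> // p IHp s1 s2 n1 n2 lt12 szn szN subD cnt.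
set T := (X in uniform_comb _ X _).
(* The inner induction covers these brackets: both words precede [leaves s2], so whichever becomes
   the second entry has smaller rank. The [lex] clause of the conclusion is there to supply this
   condition. *)
have pair t1 t2 : NLSW gt t1 -> NLSW gt t2 ->
    perm_eq (leaves t1 ++ leaves t2) (leaves s1 ++ leaves s2) ->
    lex (leaves t1) (leaves s2) -> lex (leaves t2) (leaves s2) ->
    comb T (fun m => lie (naeval (projT2 m) t1) (naeval (projT2 m) t2)).
  wlog: t1 t2 / lex (leaves t1) (leaves t2).
    have [E|/(lex_total gt_irr gt_total)] := eqVneq (leaves t1) (leaves t2).
      move=> _ nt1 nt2 _ _ _.
      have <- := NLSW_inj gt_irr gt_trans gt_total nt1 nt2 E.
      by apply: uniform_comb_eq (uniform_comb0 _ _) => m; rewrite liexx.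
    move=> /orP[lt|lt] H nt1 nt2 pe lt1 lt2; first exact: H.
    have pe' : perm_eq (leaves t2 ++ leaves t1) (leaves s1 ++ leaves s2).
      by rewrite perm_catC.
    apply: uniform_comb_eq (uniform_combN (H _ _ lt nt2 nt1 pe' lt2 lt1)) => m.
    by rewrite lie_antisym.
  move=> lt nt1 nt2 pe lt1 lt2.
  have t2D : leaves t2 \in bounded_words D N.
    apply: mem_bounded_words.
      by move: szN; rewrite -(perm_size pe) size_cat; apply/leq_trans/leq_addl.
    by move=> a at2; apply: subD; rewrite -(perm_mem pe) mem_cat at2 orbT.
  apply: uniform_combW (IHp t1 t2 nt1 nt2 lt _ _ _ _).
  - move=> t [nt pt ltt]; split=> //; first exact: perm_trans pe.
    exact: lex_trans ltt lt2.
  - by rewrite (perm_size pe).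
  - by rewrite (perm_size pe).
  - by move=> a; rewrite (perm_mem pe); apply: subD.
  - exact: leq_trans (count_lex_lt gt_irr gt_trans t2D lt2) _.
have lyndon : NLSW gt (NANode s1 s2) ->
    comb T (fun m => lie (naeval (projT2 m) s1) (naeval (projT2 m) s2)).
  move=> n12; apply: (uniform_combU _ (i := NANode s1 s2)).
  split=> //=.
  have /(ALSW_suffixP gt_irr gt_trans gt_total)[_] := NLSW_ALSW n12.
  by apply => //; apply: naleaves_neq0.
have lw : ALSW gt (leaves s1 ++ leaves s2).
  by apply: ALSW_cat => //; apply: NLSW_ALSW.
case: s1 n1 lt12 szn szN subD T pair lyndon lw
  => [a|u1 u2] n1 lt12 szn szN subD T pair lyndon lw; first by apply: lyndon.
have [geu2|ltu2] := boolP (lex_ge gt (leaves s2) (leaves u2)).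
  by apply: lyndon.
have {ltu2} u2_lt : lex (leaves u2) (leaves s2).
  move: ltu2; rewrite /lex_ge negb_or => /andP[ne /negbTE nlt].
  by have := lex_total gt_irr gt_total ne; rewrite nlt.
have [/= w12 [nu1 nu2 _]] := n1.
have u1_lt : lex (leaves u1) (leaves s2).
  apply: lex_trans lt12 => //=; rewrite lex_prefix //; exact/eqP/naleaves_neq0.
rewrite /= -catA in szn szN subD.
have sub23 :
    subseq (leaves u2 ++ leaves s2) (leaves u1 ++ leaves u2 ++ leaves s2).
  exact: suffix_subseq.
have sub13 :
    subseq (leaves u1 ++ leaves s2) (leaves u1 ++ leaves u2 ++ leaves s2).
  by apply: cat_subseq => //; apply: suffix_subseq.
have sz0 t : (0 < size (leaves t))%N.
  by rewrite lt0n size_eq0; apply/eqP/naleaves_neq0.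
(* The total length drops, so the outer induction applies, with the rank bound chosen afresh. *)
have IH t : NLSW gt t -> lex (leaves t) (leaves s2) ->
    subseq (leaves t ++ leaves s2) (leaves u1 ++ leaves u2 ++ leaves s2) ->
    (size (leaves t ++ leaves s2)
      < size (leaves u1 ++ leaves u2 ++ leaves s2))%N ->
    comb (fun t' => [/\ NLSW gt t', perm_eq (leaves t') (leaves t ++ leaves s2)
                      & lex (leaves t') (leaves s2)])
         (fun m => lie (naeval (projT2 m) t) (naeval (projT2 m) s2)).
  move=> nt tlt sub szt; apply: (IHn _ t s2 nt n2 tlt _ _ _ (leqnn _)).
  - exact: leq_trans szt _.
  - exact: leq_trans (ltnW szt) szN.
  - by move=> a /(mem_subseq sub)/subD.
(* The inner brackets with [s2] are shorter and fall under [IH]; the outer ones use all the letters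
   again and fall under [pair]. *)
apply: (@uniform_comb_eq _ _ _ _ _ _ _ (fun m =>
  lie (lie (naeval (projT2 m) u1) (naeval (projT2 m) s2)) (naeval (projT2 m) u2)
  + lie (naeval (projT2 m) u1)
        (lie (naeval (projT2 m) u2) (naeval (projT2 m) s2)))).
  by move=> m /=; rewrite lie_leibniz.
apply: uniform_combD.
  apply: (uniform_comb_lie (T := eq u2) (IH u1 nu1 u1_lt sub13 _)).
  - by rewrite !size_cat ltn_add2l -[X in (X < _)%N]add0n ltn_add2r.
  - exact: uniform_combU.
  move=> t _ [nt pt ltt] <-; apply: pair => //=.
  by rewrite perm_sym perm_catAC perm_cat2r perm_sym.
apply: (uniform_comb_lie (S := eq u1) _ (IH u2 nu2 u2_lt sub23 _)).
- exact: uniform_combU.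
- by rewrite [X in (_ < X)%N]size_cat -[X in (X < _)%N]add0n ltn_add2r.
move=> _ t <- [nt pt ltt]; apply: pair => //=.
by rewrite -catA perm_cat2l.
Qed.

(** Antisymmetry reduces to ordered pairs, and equal words mean equal trees, whose bracket vanishes.
    The letters are recorded because a bracketing is later substituted for each of them. *)
Lemma NLSW_lie s1 s2 : NLSW gt s1 -> NLSW gt s2 ->
  comb (fun t => NLSW gt t /\ perm_eq (leaves t) (leaves s1 ++ leaves s2))
       (fun m => lie (naeval (projT2 m) s1) (naeval (projT2 m) s2)).
Proof.
have ordered t1 t2 : NLSW gt t1 -> NLSW gt t2 -> lex (leaves t1) (leaves t2) ->
    comb (fun t => NLSW gt t /\ perm_eq (leaves t) (leaves t1 ++ leaves t2))
         (fun m => lie (naeval (projT2 m) t1) (naeval (projT2 m) t2)).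
  move=> n1 n2 lt12.
  apply: uniform_combW (@NLSW_lie_ordered (leaves t1 ++ leaves t2) _ _ _ t1 t2
    n1 n2 lt12 (leqnn _) (leqnn _) _ (leqnn _)) => // t [nt pt _].
  by split.
move=> n1 n2.
have [E|/(lex_total gt_irr gt_total)/orP[lt|lt]] :=
  eqVneq (leaves s1) (leaves s2).
- have <- := NLSW_inj gt_irr gt_trans gt_total n1 n2 E.
  by apply: uniform_comb_eq (uniform_comb0 _ _) => m; rewrite liexx.
- exact: ordered.
apply: (@uniform_comb_eq _ _ _ _ _ _ _ (fun m =>
  - lie (naeval (projT2 m) s2) (naeval (projT2 m) s1))).
  by move=> m; rewrite lie_antisym.
apply: uniform_combN; apply: uniform_combW (ordered _ _ n2 n1 lt) => t [nt pt].
by split=> //; rewrite perm_sym perm_catC perm_sym.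
Qed.

End LyndonBracket.

(** * Bracketed words and words with a star *)

Section BracketedWords.
Variable X : Type.
Implicit Types (u v w : bword X) (s : naword (bprime X)) (t : nabword X).

Lemma primes_of_bmul u v : primes_of (bmul u v) = primes_of u ++ primes_of v.
Proof. by elim: u => [p|p u IHu] //=; rewrite IHu. Qed.

Lemma primes_of_neq0 u : primes_of u <> [::].
Proof. by case: u. Qed.

Lemma primes_of_inj : injective (@primes_of X).
Proof.
elim=> [p|p u IHu] [q|q v] //= [->].
- by [].
- by move=> /esym/primes_of_neq0.
- by move=> /primes_of_neq0.
- by move/IHu->.
Qed.

Fixpoint bword_of s : bword X :=
  match s with
  | NALeaf p => BOne p
  | NANode l r => bmul (bword_of l) (bword_of r)
  end.

Lemma primes_of_bword_of s : primes_of (bword_of s) = naleaves s.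
Proof. by elim: s => //= l <- r <-; rewrite primes_of_bmul. Qed.

(** The name is justified only for Lyndon-Shirshov [t], where this is the largest word of the
    commutator expansion. *)
Fixpoint leading_word t : bword X :=
  match t with
  | NVar x => BOne (BVar x)
  | NBrack t => BOne (BBrack (leading_word t))
  | NMul l r => bmul (leading_word l) (leading_word r)
  end.

(** Multiplying such a word by the star gives a context with one star, through which a monomial
    order is compatible with products. *)
Fixpoint starless w : bword (option X) :=
  match w with
  | BOne p => BOne (starless_prime p)
  | BCons p w => BCons (starless_prime p) (starless w)
  end
with starless_prime (p : bprime X) : bprime (option X) :=
  match p with
  | BVar x => BVar (Some x)
  | BBrack w => BBrack (starless w)
  end.

Scheme bword_mut := Induction for bword Sort Prop
with bprime_mut := Induction for bprime Sort Prop.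

Lemma nstar_starless w : nstar (starless w) = 0%N.
Proof.
apply: (@bword_mut _ (fun w => nstar (starless w) = 0%N)
  (fun p => nstar_prime (starless_prime p) = 0%N)) => //= p pP {}w wP.
by rewrite pP wP.
Qed.

Lemma bsubst_starless u w : bsubst u (starless w) = w.
Proof.
apply: (@bword_mut _ (fun w => bsubst u (starless w) = w)
  (fun p => bsubst_prime u (starless_prime p) = BOne p)) => //=.
- by move=> p pP {}w wP; rewrite pP wP.
- by move=> {}w wP; rewrite wP.
Qed.

Lemma nstar_bmul (q r : bword (option X)) :
  nstar (bmul q r) = (nstar q + nstar r)%N.
Proof. by elim: q => //= p q ->; rewrite addnA. Qed.

Lemma bsubst_bmul u q r : bsubst u (bmul q r) = bmul (bsubst u q) (bsubst u r).
Proof. by elim: q => //= p q ->; rewrite bmulA. Qed.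

End BracketedWords.

(* Invariant monomial orders and the bracketing of a word *)
Scheme bracketing_mut := Minimality for bracketing Sort Prop
with bracketing_tree_mut := Minimality for bracketing_tree Sort Prop.

Lemma total_order_max (T : eqType) (ge : rel T) (r : seq T) :
  total ge -> transitive ge -> r != [::] ->
  exists2 x, x \in r & {in r, forall y, ge x y}.
Proof.
move=> tot tr; elim: r => // x r IHr _.
have refl y : ge y y by case/orP: (tot y y).
have [->|/IHr[y yr ymax]] := eqVneq r [::].
  by exists x => [|y]; rewrite inE // => /eqP->.
case/orP: (tot x y) => [xy|yx].
  exists x; first by rewrite inE eqxx.
  move=> z; rewrite inE => /orP[/eqP->//|/ymax]; exact: tr.
exists y; first by rewrite inE yr orbT.
by move=> z; rewrite inE => /orP[/eqP->|/ymax].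
Qed.

Section InvariantOrder.
Variables (X : Type) (ge : rel (bword X)).
Hypothesis ge_inv : invariant_monomial_order ge.
Local Notation sgt := (strict ge).
Local Notation pgt := (prime_gt ge).
Implicit Types (u v w : bword X) (s : naword (bprime X)) (t : nabword X).

Let ge_chain : wo_chain (fun u v => ge v u) predT.
Proof. by case: ge_inv => -[wo _] _; apply: withinW. Qed.

Lemma ge_refl : reflexive ge.
Proof. by move=> u; apply: (wo_chain_reflexive ge_chain). Qed.

Lemma ge_anti : antisymmetric ge.
Proof.
by move=> u v uv; apply: (wo_chain_antisymmetric ge_chain) => //; rewrite andbC.
Qed.

Lemma ge_total : total ge.
Proof. by move=> u v; apply: (wo_chainW ge_chain). Qed.

Lemma ge_trans : transitive ge.
Proof.
case: ge_inv => -[wo _] _ v u w uv vw.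
(* If the least of the three words is [u] or [v], antisymmetry identifies two neighbours; if it is
   [w], the claim is immediate. *)
have [|z [[zA zmin] _]] := wo (mem [:: u; v; w]).
  by exists u; rewrite !inE eqxx.
move: zA; rewrite !inE => /or3P[] /eqP zE.
- have -> : u = v; last by [].
  by apply: ge_anti; rewrite uv -zE zmin // !inE eqxx ?orbT.
- have -> : w = v; last by [].
  by apply: ge_anti; rewrite vw andbT -zE zmin // !inE eqxx ?orbT.
- by rewrite -zE zmin // !inE eqxx.
Qed.

Lemma sgt_irr : irreflexive sgt.
Proof. by move=> u; rewrite /strict eqxx andbF. Qed.

Lemma sgtW u v : sgt u v -> ge u v.
Proof. by case/andP. Qed.

Lemma sgt_ge_trans v u w : sgt u v -> ge v w -> sgt u w.
Proof.
case/andP=> uv neq vw; apply/andP; split; first exact: ge_trans vw.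
apply/eqP => uw; move/eqP: neq; apply; apply: ge_anti.
by rewrite uv uw vw.
Qed.

Lemma pgt_irr : irreflexive pgt.
Proof. by move=> p; apply: sgt_irr. Qed.

Lemma pgt_trans : transitive pgt.
Proof. by move=> q p r pq /sgtW; apply: sgt_ge_trans. Qed.

Lemma pgt_total p q : p != q -> pgt p q || pgt q p.
Proof.
move=> neq; have neq1 : BOne p != BOne q by apply: contra neq => /eqP[->].
rewrite /prime_gt /strict neq1 eq_sym neq1 !andbT; exact: ge_total.
Qed.

Lemma sgt_bmul2r v u u' : sgt u u' -> sgt (bmul u v) (bmul u' v).
Proof.
case: ge_inv => -[_ mono] _ /(mono (BCons (BVar None) (starless v))) /=.
by rewrite nstar_starless !bsubst_starless; apply.
Qed.

Lemma sgt_bmul2l v u u' : sgt u u' -> sgt (bmul v u) (bmul v u').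
Proof.
case: ge_inv => -[_ mono] _ /(mono (bmul (starless v) (BOne (BVar None)))).
by rewrite nstar_bmul nstar_starless !bsubst_bmul !bsubst_starless; apply.
Qed.

Lemma sgt_brack u u' : sgt u u' -> sgt (BOne (BBrack u)) (BOne (BBrack u')).
Proof.
case: ge_inv => -[_ mono] _.
by apply: (mono (BOne (BBrack (BOne (BVar None))))).
Qed.

Lemma ge_bmul2r v u u' : ge u u' -> ge (bmul u v) (bmul u' v).
Proof.
have [->|neq uu'] := eqVneq u u'; first by rewrite !ge_refl.
by apply/sgtW/sgt_bmul2r; rewrite /strict uu'.
Qed.

Lemma ge_bmul2l v u u' : ge u u' -> ge (bmul v u) (bmul v u').
Proof.
have [->|neq uu'] := eqVneq u u'; first by rewrite !ge_refl.
by apply/sgtW/sgt_bmul2l; rewrite /strict uu'.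
Qed.

(** The two products have the same primes up to order, so invariance turns the lexicographic
    comparison of the Lyndon condition into one for [ge]. *)
Lemma ALSW_sgt_rot u v :
  ALSW pgt (primes_of u ++ primes_of v) -> sgt (bmul u v) (bmul v u).
Proof.
move=> [_ /(_ _ _ (@primes_of_neq0 _ u) (@primes_of_neq0 _ v) erefl)].
rewrite -!primes_of_bmul => lt; apply/andP; split.
  case: ge_inv => _ ->; first by rewrite /lex_ge lt orbT.
  by rewrite !primes_of_bmul perm_catC.
by apply/eqP => E; move: lt; rewrite E (lex_irr pgt_irr).
Qed.

Lemma ALSW1 (p : bprime X) : ALSW pgt [:: p].
Proof. by split=> // -[|a [|b u]] [|c v]. Qed.

Definition ALSBW_prime (p : bprime X) : Prop :=
  if p is BBrack w then ALSBW ge w else True.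

Lemma ALSBW_stage_leq n m w :
  (n <= m)%N -> ALSBW_stage ge n w -> ALSBW_stage ge m w.
Proof.
elim: n m w => [|n IHn] [|m] w //= nm [lw wP]; split=> // -[x|w'] // w'w.
- by have := wP _ w'w.
- by apply: (IHn m) => //; have := wP _ w'w.
Qed.

(** A word has finitely many primes, so a single stage contains the bodies of all its bracketed
    primes. *)
Lemma ALSBWP w :
  ALSBW ge w <->
  ALSW pgt (primes_of w) /\ forall p, p \in primes_of w -> ALSBW_prime p.
Proof.
split=> [[n]|[lw wP]].
  case: n => [|n] /= [lw wP]; split=> // -[x|w'] // /wP //.
  by exists n.
suff [n nP] : exists n, forall w',
    BBrack w' \in primes_of w -> ALSBW_stage ge n w'.
  by exists n.+1; split=> // -[x|w'] // /nP.
elim: (primes_of w) wP => [|p r IHr] wP; first by exists 0%N.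
have [|n nP] := IHr; first by move=> q qr; apply: wP; rewrite inE qr orbT.
have [m mP] : exists m, forall w', p = BBrack w' -> ALSBW_stage ge m w'.
  case: p wP => [x|w'] wP; first by exists 0%N.
  by have [|m mP] := wP (BBrack w'); rewrite ?inE ?eqxx //; exists m => _ [<-].
exists (maxn m n) => w'; rewrite inE => /orP[/eqP/esym/mP|/nP].
  exact/ALSBW_stage_leq/leq_maxl.
exact/ALSBW_stage_leq/leq_maxr.
Qed.

Lemma bracketing_tree_leading s t :
  bracketing_tree ge s t -> leading_word t = bword_of s.
Proof.
move=> st; apply: (@bracketing_tree_mut _ ge (fun w t => leading_word t = w)
  (fun s t => leading_word t = bword_of s)) (st) => //=.
- by move=> w s' t' _ sE _ ->; apply: primes_of_inj; rewrite primes_of_bword_of.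
- by move=> w t' _ ->.
- by move=> s1 s2 t1 t2 _ -> _ ->.
Qed.

Lemma bracketing_leading w t : bracketing ge w t -> leading_word t = w.
Proof.
(* Enclosing [w] in a bracket turns its bracketing into that of a one-leaf tree. *)
by move=> /BracketingBrack/bracketing_tree_leading /= [].
Qed.

Lemma bracketing_tree_fun s t t' :
  bracketing_tree ge s t -> bracketing_tree ge s t' -> t = t'.
Proof.
have NLSW_bracketed_inj := NLSW_inj pgt_irr pgt_trans pgt_total.
move=> st; move: t'; apply: (@bracketing_tree_mut _ ge
  (fun w t => forall t', bracketing ge w t' -> t = t')
  (fun s t => forall t', bracketing_tree ge s t' -> t = t')) (st) => //.
- move=> w s1 t1 n1 E1 _ IH t' wt'.
  case: _ _ / wt' E1 => {}w s2 t2 n2 E2 st2 E1.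
  by apply: IH; rewrite (NLSW_bracketed_inj _ _ n1 n2) // E1.
- by move=> x t' xt'; inversion xt'.
- by move=> w t1 _ IH t' wt'; inversion wt' as [|w' t2 wt2|]; rewrite (IH t2).
move=> s1 s2 t1 t2 _ IH1 _ IH2 t' st'.
by inversion st' as [| |s1' s2' t1' t2' st1 st2]; rewrite (IH1 t1') ?(IH2 t2').
Qed.

Lemma bracketing_tree_brackets s t p :
  bracketing_tree ge s t -> p \in naleaves s ->
  exists t', bracketing_tree ge (NALeaf p) t'.
Proof.
elim: s t => [q|s1 IH1 s2 IH2] t st /=.
  by rewrite inE => /eqP->; exists t.
inversion st as [| |s1' s2' t1 t2 st1 st2].
by rewrite mem_cat => /orP[/(IH1 _ st1)|/(IH2 _ st2)].
Qed.

(* [t0] is a junk value, for the primes that have no bracketing. *)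
Definition prime_bracketing t0 (p : bprime X) : nabword X :=
  if pselect (exists t, bracketing_tree ge (NALeaf p) t) is left ex
  then projT1 (cid ex) else t0.

Fixpoint tree_bracketing t0 s : nabword X :=
  match s with
  | NALeaf p => prime_bracketing t0 p
  | NANode l r => NMul (tree_bracketing t0 l) (tree_bracketing t0 r)
  end.

Lemma tree_bracketingP t0 s :
  (forall p, p \in naleaves s -> exists t, bracketing_tree ge (NALeaf p) t) ->
  bracketing_tree ge s (tree_bracketing t0 s).
Proof.
elim: s => [p|s1 IH1 s2 IH2] sP /=.
  have ex : exists t, bracketing_tree ge (NALeaf p) t by apply: sP; rewrite inE.
  by rewrite /prime_bracketing; case: pselect => // ex'; case: (cid ex').
by constructor; [apply: IH1|apply: IH2] => p ps; apply: sP;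
  rewrite mem_cat ps ?orbT.
Qed.

Lemma NLSBW_var x : NLSBW ge (NVar x).
Proof.
exists (BOne (BVar x)).
  by exists 0%N; split=> [|p]; [exact: ALSW1|rewrite inE => /eqP->].
apply: (@BracketingWord _ _ _ (NALeaf (BVar x))) => //; last by constructor.
by split=> //; apply: ALSW1.
Qed.

Lemma NLSBW_brack t : NLSBW ge t -> NLSBW ge (NBrack t).
Proof.
move=> [w lw wt]; exists (BOne (BBrack w)).
  by apply/ALSBWP; split=> [|p]; [exact: ALSW1|rewrite inE => /eqP->].
apply: (@BracketingWord _ _ _ (NALeaf (BBrack w))) => //; last by constructor.
by split=> //; apply: ALSW1.
Qed.

Lemma NLSBW_leading_inj t t' :
  NLSBW ge t -> NLSBW ge t' -> leading_word t = leading_word t' -> t = t'.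
Proof.
move=> [w _ wt] [w' _ wt'].
rewrite (bracketing_leading wt) (bracketing_leading wt') => ww'.
have := bracketing_tree_fun (BracketingBrack wt).
by rewrite ww' => /(_ _ (BracketingBrack wt')) [].
Qed.

End InvariantOrder.

(** * Leading words and linear independence *)

Section FreeOperatedLie.
Variables (k : fieldType) (X : Type) (ge : rel (bword X)).
Hypothesis ge_inv : invariant_monomial_order ge.
Local Notation sgt := (strict ge).
Local Notation pgt := (prime_gt ge).
Implicit Types (u v w : bword X) (t : nabword X) (a b : bwalg k X).

(** One support condition says both that [w] has coefficient 1 and that it dominates the other
    words. *)
Definition has_leading w a : Prop := supp_in (sgt w) (a - << w >>).

Lemma has_leadingU w : has_leading w (<< w >> : bwalg k X).
Proof. by rewrite /has_leading subrr; apply: supp_in0. Qed.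

Lemma has_leading_supp w a : has_leading w a -> supp_in (ge w) a.
Proof.
move=> wa; rewrite -[a](subrK (<< w >> : bwalg k X)).
apply: supp_inD; last by apply: supp_inU; apply: ge_refl.
by apply: supp_inW wa => i; apply: sgtW.
Qed.

Lemma has_leading_coeff w a : has_leading w a -> a@_w = 1.
Proof.
move=> wa; have : w \notin msupp (a - << w >>).
  by apply/negP => /wa; rewrite sgt_irr.
by rewrite -mcoeff_eq0 mcoeffB mcoeffUU subr_eq0 => /eqP.
Qed.

Lemma supp_in_mul (S T R : bword X -> Prop) a b :
  supp_in S a -> supp_in T b -> (forall u v, S u -> T v -> R (bmul u v)) ->
  supp_in R (bw_mul a b).
Proof.
move=> Sa Tb STR; apply: (supp_in_lext Sa) => u Su.
by apply: (supp_in_lext Tb) => v Tv; apply: supp_inU; apply: STR.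
Qed.

Lemma has_leading_op w a :
  has_leading w a -> has_leading (BOne (BBrack w)) (bw_op a).
Proof.
move=> wa; rewrite /has_leading.
have -> : bw_op a - << BOne (BBrack w) >> = bw_op (a - << w >>).
  rewrite (linear_D (@bw_op_linear k X)) (linear_N (@bw_op_linear k X)).
  by rewrite [bw_op << w >>]lextU.
by apply: (supp_in_lext wa) => u wu; apply: supp_inU; apply: sgt_brack.
Qed.

(** In [ab - uv = (a - u)b + u(b - v)] both terms contain only words below [uv]; the words of [ba]
    are at most [vu], which is below [uv] by assumption. *)
Lemma has_leading_lie u v a b :
  sgt (bmul u v) (bmul v u) -> has_leading u a -> has_leading v b ->
  has_leading (bmul u v) (bw_lie a b).
Proof.
move=> uv ua vb; rewrite /has_leading /bw_lie.
have -> : bw_mul a b - bw_mul b a - << bmul u v >> =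
    bw_mul (a - << u >>) b + bw_mul << u >> (b - << v >>) - bw_mul b a.
  have telescope (V : zmodType) (x y z d : V) :
      x - d - z = x - y + (y - z) - d by rewrite addrA subrK addrAC.
  rewrite (bw_mulBl a << u >> b) (bw_mulBr << u >> b << v >>) (bw_mulUU k u v).
  exact: telescope.
apply: supp_inB; first apply: supp_inD.
- apply: supp_in_mul ua (has_leading_supp vb) _ => u' v' uu' vv'.
  exact: sgt_ge_trans (sgt_bmul2r ge_inv v uu') (ge_bmul2l ge_inv u' vv').
- apply: (supp_in_mul (S := eq u)) vb _ => [|_ v' <- vv'].
    exact: supp_inU.
  exact: sgt_bmul2l.
- apply: supp_in_mul (has_leading_supp vb) (has_leading_supp ua) _.
  move=> v' u' vv' uu'; apply: sgt_ge_trans uv _ => //.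
  exact: ge_trans (ge_bmul2r ge_inv u vv') (ge_bmul2l ge_inv v' uu').
Qed.

Lemma bracketing_has_leading w t :
  bracketing ge w t -> has_leading w (nab_eval k t).
Proof.
(* [bracketing_tree] alone does not make its tree a Lyndon-Shirshov one, hence the premise in the
   second predicate; subtrees inherit it. *)
move=> wt; apply: (@bracketing_mut _ ge
  (fun w t => has_leading w (nab_eval k t))
  (fun s t => NLSW pgt s -> has_leading (bword_of s) (nab_eval k t))) (wt)
  => //=.
- move=> w' s t' ns sE _ /(_ ns).
  have -> // : bword_of s = w'.
  by apply: primes_of_inj; rewrite primes_of_bword_of.
- by move=> x _; apply: has_leadingU.
- by move=> w' t' _ wt' _; apply: has_leading_op.
move=> s1 s2 t1 t2 _ IH1 _ IH2 [lw [n1 n2 _]].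
apply: has_leading_lie; [|exact: IH1|exact: IH2].
by apply: ALSW_sgt_rot => //; rewrite !primes_of_bword_of.
Qed.

Lemma NLSBW_has_leading t :
  NLSBW ge t -> has_leading (leading_word t) (nab_eval k t).
Proof.
move=> [w _ wt]; rewrite (bracketing_leading wt).
exact: bracketing_has_leading.
Qed.

Lemma NLSBW_free (c : {malg k[nabword X]}) :
  supp_in (NLSBW ge) c -> lext (@nab_eval k X) c = 0 -> c = 0.
Proof.
move=> Bc c0; apply/malgP => t; rewrite mcoeff0; apply/eqP.
rewrite mcoeff_eq0; apply/negP => tc.
have [|w wc wmax] := @total_order_max _ ge
    [seq leading_word t | t <- enum_fset (msupp c)]
    (ge_total ge_inv) (ge_trans ge_inv).
  by apply: contraTneq (map_f (@leading_word X) tc) => ->.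
have /mapP[t1 t1c wE] := wc.
(* Another [t2] of the support whose evaluation contains [w] would have a leading word at least [w],
   so equal to [w] by maximality, and [t2] would be [t1]. *)
have : (lext (@nab_eval k X) c)@_w = c@_t1.
  rewrite /lext raddf_sum /= (bigD1_seq t1) //=; last exact: fset_uniq.
  rewrite mcoeffZ wE has_leading_coeff ?mulr1; last exact/NLSBW_has_leading/Bc.
  rewrite big1_seq ?addr0 // => t2 /andP[ne t2c].
  rewrite mcoeffZ (@mcoeff_outdom _ _ _ (leading_word t1)) ?mulr0 //.
  apply/negP => /(has_leading_supp (NLSBW_has_leading (Bc _ t2c))) le21.
  move/eqP: ne; apply; apply: (NLSBW_leading_inj ge_inv); [exact: Bc|exact: Bc|].
  apply: (ge_anti ge_inv); rewrite le21 -wE wmax //.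
  by apply/mapP; exists t2.
rewrite c0 mcoeff0 => /esym/eqP; rewrite mcoeff_eq0 => /negP; exact.
Qed.

(** * Spanning and the universal property *)

Fixpoint nab_interp (L : opLieAlgType k) (f : X -> L) t : L :=
  match t with
  | NVar x => f x
  | NBrack t => lop (nab_interp f t)
  | NMul t1 t2 => lie (nab_interp f t1) (nab_interp f t2)
  end.

Lemma nab_evalE : nab_interp (@bw_var k X) =1 @nab_eval k X.
Proof.
elim=> [x|t IHt|t1 IH1 t2 IH2]; first exact: erefl.
  exact: (congr1 (@bw_op k X) IHt).
exact: (congr2 (@bw_lie k X) IH1 IH2).
Qed.

Lemma nab_interp_tree (L : opLieAlgType k) (f : X -> L) t0 s :
  nab_interp f (tree_bracketing ge t0 s) =
  naeval (fun p => nab_interp f (prime_bracketing ge t0 p)) s.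
Proof. by elim: s => //= s1 -> s2 ->. Qed.

(** The result for trees is applied with primes as letters, each interpreted as the value of its
    bracketing. The trees obtained have the same leaves, so substituting the bracketings gives
    elements of [NLSBW ge]. *)
Lemma NLSBW_lie t1 t2 :
  NLSBW ge t1 -> NLSBW ge t2 ->
  uniform_comb (L := fun m : {L : opLieAlgType k & X -> L} => projT1 m)
    (fun m => nab_interp (projT2 m)) (NLSBW ge)
    (fun m => lie (nab_interp (projT2 m) t1) (nab_interp (projT2 m) t2)).
Proof.
move=> [w1 /ALSBWP[_ p1] wt1] [w2 /ALSBWP[_ p2] wt2].
case: _ _ / wt1 p1 => {}w1 s1 {}t1 n1 E1 st1 p1.
case: _ _ / wt2 p2 => {}w2 s2 {}t2 n2 E2 st2 p2.
have [c Sc cE] := @NLSW_lie k _ _ (@pgt_irr _ ge) (pgt_trans ge_inv)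
  (pgt_total ge_inv) _ _ n1 n2.
(* [t1] is only a default value: every leaf of the trees in question has a bracketing. *)
exists (lext (fun s => << tree_bracketing ge t1 s >>) c).
  apply: (supp_in_lext Sc) => s [ns ps]; apply: supp_inU.
  exists (bword_of s).
    apply/ALSBWP; rewrite primes_of_bword_of; split.
      exact: NLSW_ALSW.
    move=> p; rewrite (perm_mem ps) E1 E2 mem_cat => /orP[].
      exact: p1.
    exact: p2.
  apply: (BracketingWord ns); first by rewrite primes_of_bword_of.
  apply: tree_bracketingP => p; rewrite (perm_mem ps) mem_cat => /orP[].
    exact: bracketing_tree_brackets st1.
  exact: bracketing_tree_brackets st2.
move=> [L f] /=; rewrite lext_lext.
pose g p := nab_interp f (prime_bracketing ge t1 p).
have interpE s t : bracketing_tree ge s t -> nab_interp f t = naeval g s.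
  move=> st; rewrite -nab_interp_tree; congr nab_interp.
  apply: (bracketing_tree_fun ge_inv st); apply: tree_bracketingP => p.
  exact: bracketing_tree_brackets st.
rewrite (interpE _ _ st1) (interpE _ _ st2).
rewrite (cE (existT (fun L : lieAlgType k => bprime X -> L)
  (L : lieAlgType k) g)).
by apply: (@eq_lext _ _ _ _ _ _ _ Sc) => s _; rewrite lextU nab_interp_tree.
Qed.

Lemma NLSBW_comb_lie (c d : {malg k[nabword X]}) :
  supp_in (NLSBW ge) c -> supp_in (NLSBW ge) d ->
  exists2 e : {malg k[nabword X]}, supp_in (NLSBW ge) e &
  forall (L : opLieAlgType k) (f : X -> L),
    lie (lext (nab_interp f) c) (lext (nab_interp f) d) = lext (nab_interp f) e.
Proof.
move=> Bc Bd.
have [|e Be eE] := uniform_comb_lie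
  (L := fun m : {L : opLieAlgType k & X -> L} => projT1 m)
  (e := fun m => nab_interp (projT2 m)) (U := NLSBW ge)
  (ex_intro2 _ _ c Bc (fun m => erefl)) (ex_intro2 _ _ d Bd (fun m => erefl)).
  exact: NLSBW_lie.
by exists e => // L f; apply: (eE (existT _ L f)).
Qed.

Lemma NLSBW_comb_op (c : {malg k[nabword X]}) : supp_in (NLSBW ge) c ->
  exists2 e : {malg k[nabword X]}, supp_in (NLSBW ge) e &
  forall (L : opLieAlgType k) (f : X -> L),
    lop (lext (nab_interp f) c) = lext (nab_interp f) e.
Proof.
move=> Bc; exists (lext (fun t => << NBrack t >>) c).
  by apply: (supp_in_lext Bc) => t Bt; apply: supp_inU; apply: NLSBW_brack.
move=> L f; rewrite lext_lext (linear_lext _ _ (@lop_linear _ L)).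
by apply: eq_lext Bc _ => t _; rewrite lextU.
Qed.

Lemma lext_nab_evalE c :
  lext (nab_interp (@bw_var k X)) c = lext (@nab_eval k X) c.
Proof. by apply: eq_bigr => t _; rewrite nab_evalE. Qed.

Lemma NLSBW_span a : OLie a ->
  exists2 c : {malg k[nabword X]}, supp_in (NLSBW ge) c &
    a = lext (@nab_eval k X) c.
Proof.
elim=> [x||c {}a b _ [ca Ba ->] _ [cb Bb ->]|{}a b _ [ca Ba ->] _ [cb Bb ->]
  |{}a _ [ca Ba ->]].
- by exists << NVar x >>; [apply: supp_inU; exact: NLSBW_var|rewrite lextU].
- by exists 0; [exact: supp_in0|rewrite (linear_0 (lext_linear _))].
- by exists (c *: ca + cb); [exact: supp_in_lin|rewrite lext_linear].
- have [e Be eE] := NLSBW_comb_lie Ba Bb; exists e => //.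
  by rewrite -!lext_nab_evalE -eE.
have [e Be eE] := NLSBW_comb_op Ba; exists e => //.
by rewrite -!lext_nab_evalE -eE.
Qed.

Lemma OLie_nab_eval t : OLie (nab_eval k t).
Proof.
elim: t => [x|t IHt|t1 IH1 t2 IH2] /=; first exact: OLieVar.
  exact: OLieOp.
exact: OLieLie.
Qed.

Lemma olie_free : free_opLie (@olie_var k X).
Proof.
move=> L f.
(* [C x] is the coordinate vector of [x]; by independence, [CE] identifies it with any admissible
   combination representing [x]. *)
have [C CP] := choice (fun x : olie k X =>
  let: ex_intro2 c Bc E := NLSBW_span (elimT (OLieP _) (olie_valP x)) in
  ex_intro (fun c =>
    supp_in (NLSBW ge) c /\ olie_val x = lext (@nab_eval k X) c)
    c (conj Bc E)).
have CE x c : supp_in (NLSBW ge) c ->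
    olie_val x = lext (@nab_eval k X) c -> C x = c.
  move=> Bc xE; have [BC CxE] := CP x; apply/eqP; rewrite -subr_eq0; apply/eqP.
  apply: NLSBW_free; first exact: supp_inB.
  rewrite (linear_D (lext_linear _)) (linear_N (lext_linear _)).
  by rewrite -CxE -xE subrr.
exists (fun x => lext (nab_interp f) (C x)); split.
- split.
  + move=> c x y; have [Bx xE] := CP x; have [By yE] := CP y.
    rewrite (CE _ (c *: C x + C y)) ?lext_linear //; first exact: supp_in_lin.
    by rewrite /= -xE -yE.
  + move=> x y; have [Bx xE] := CP x; have [By yE] := CP y.
    (* In the semigroup algebra [e] represents the bracket of [x] and [y], so it is its coordinate
       vector; in [L] the same [e] gives the bracket of the images. *)
    have [e Be eE] := NLSBW_comb_lie Bx By.
    by rewrite (CE _ e) ?eE // -lext_nab_evalE -eE !lext_nab_evalE -xE -yE.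
  + move=> x; have [Bx xE] := CP x; have [e Be eE] := NLSBW_comb_op Bx.
    by rewrite (CE _ e) ?eE // -lext_nab_evalE -eE lext_nab_evalE -xE.
- move=> x; rewrite (CE _ << NVar x >>) ?lextU //.
  apply: supp_inU; exact: NLSBW_var.
move=> psi [psi_lin psi_lie psi_op] psi_var.
(* Uniqueness is checked on evaluations of non-associative words, which span. Letting [x] vary keeps
   membership proofs out of the induction on [t]. *)
suff psiE t x : olie_val x = nab_eval k t -> psi x = nab_interp f t.
  move=> x; have [Bx xE] := CP x.
  pose E t : olie k X := OLieElt (introT (OLieP _) (OLie_nab_eval t)).
  have {1}-> : x = lext E (C x).
    have val_lin : linear (@olie_val k X) by move=> c a b.
    apply: val_inj; apply: (etrans xE); apply: esym.
    exact: (linear_lext E (C x) val_lin).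
  rewrite (linear_lext _ _ psi_lin).
  by apply: (eq_lext (S := NLSBW ge)) => // t _; apply: psiE.
elim: t x => [y|t IHt|t1 IH1 t2 IH2] x /= xE.
- by rewrite -psi_var; congr psi; apply: val_inj.
- pose y : olie k X := OLieElt (introT (OLieP _) (OLie_nab_eval t)).
  by rewrite -(IHt y) // -psi_op; congr psi; apply: val_inj.
pose y1 : olie k X := OLieElt (introT (OLieP _) (OLie_nab_eval t1)).
pose y2 : olie k X := OLieElt (introT (OLieP _) (OLie_nab_eval t2)).
by rewrite -(IH1 y1) // -(IH2 y2) // -psi_lie; congr psi; apply: val_inj.
Qed.

End FreeOperatedLie.

Theorem theorem2p13 (k : fieldType) (X : Type) (leX : rel X)
    (leX_wo : well_order leX) (ge_IM : rel (bword X))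
    (ge_IM_inv : invariant_monomial_order ge_IM) :
  free_opLie (@olie_var k X) /\
  linear_basis (NLSBW ge_IM) (@nab_eval k X) (@OLie k X).
Proof.
split; first exact: olie_free ge_IM_inv.
split; first by move=> t _; apply: OLie_nab_eval.
  exact: NLSBW_free.
exact: NLSBW_span.
Qed.
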